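(* Let $(X,\sigma)$ and $(T,\tau)$ be torsion-free Toeplitz subshifts with scales $(p_n)$ and $(q_n)$ respectively. If $\operatorname{Aut}^{(\infty)}(X,\sigma)$ and $\operatorname{Aut}^{(\infty)}(T,\tau)$ are isomorphic as groups, then $(p_n)$ is equivalent to $(q_n)$, i.e. $\mathbf{v}_p((p_n))=\mathbf{v}_p((q_n))$ for every prime $p$.
   Context: Let $\mathcal{A}$ be a finite alphabet and $\sigma$ the left shift on $\mathcal{A}^{\mathbb{Z}}$. A Toeplitz sequence $u$ is one such that for every $n\in\mathbb{Z}$ there is $m\ge1$ with $u_n=u_{n+km}$ for all $k$; it is assumed non-periodic. With $\operatorname{per}_p(u)=\{k: u_k=u_{k+pm}\ \forall m\}$, a period structure of $u$ is a sequence $(p_n)$ with $p_n\mid p_{n+1}$, $\bigcup_n\operatorname{per}_{p_n}(u)=\mathbb{Z}$, and each $p_n$ essential (for $1\le p<p_n$, $\operatorname{per}_p(u)\neq\operatorname{per}_{p_n}(u)$). The Toeplitz subshift is the orbit closure of $u$ with the shift; its scale here means the period structure of $u$. For a prime $p$, $\mathbf{v}_p((p_n))=\lim_n\nu_p(p_n)\in\mathbb{N}\cup\{0,\infty\}$ where $\nu_p$ is the $p$-adic valuation. The Toeplitz subshift is torsion free if $\mathbf{v}_p((p_n))\in\{0,\infty\}$ for every prime $p$ (equivalently its maximal equicontinuous factor, the odometer $\mathbb{Z}_{(p_n)}$, is torsion free). For a homeomorphism $S$ of a compact metric space $Y$, $\operatorname{Aut}(Y,S)$ is the group of homeomorphisms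 commuting with $S$ and $\operatorname{Aut}^{(\infty)}(Y,S)=\bigcup_{n\ge1}\operatorname{Aut}(Y,S^n)$. *)

(* Defs.v *)
From mathcomp Require Import all_boot all_algebra.
Set Implicit Arguments. Unset Strict Implicit. Unset Printing Implicit Defensive.
Import GRing.Theory Num.Theory.
Local Open Scope ring_scope.

Definition seqZ (A : Type) := int -> A.

Definition shift (A : Type) (x : seqZ A) : seqZ A := fun i => x (i + 1).
Definition shiftn (A : Type) (n : nat) (x : seqZ A) : seqZ A := fun i => x (i + n%:Z).

Definition is_toeplitz (A : Type) (u : seqZ A) : Prop :=
  (forall n : int, exists m : nat, (0 < m)%N /\ forall k : int, u n = u (n + k * m%:Z))
  /\ ~ (exists m : nat, (0 < m)%N /\ forall n : int, u n = u (n + m%:Z)).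

Definition per (A : Type) (u : seqZ A) (p : nat) (k : int) : Prop :=
  forall m : int, u k = u (k + p%:Z * m).

Definition period_structure (A : Type) (u : seqZ A) (p : nat -> nat) : Prop :=
  [/\ forall n, (0 < p n)%N,
      forall n, (p n %| p n.+1)%N,
      forall k : int, exists n, per u (p n) k
    & forall n (r : nat), (1 <= r)%N -> (r < p n)%N ->
        ~ (forall k, per u r k <-> per u (p n) k)].

(* v_r((p_n)) = lim_n nu_r(p_n) in N u {oo}; None encodes oo.
   vp_is p r v <-> the limit equals v. *)
Definition vp_is (p : nat -> nat) (r : nat) (v : option nat) : Prop :=
  match v with
  | Some m => exists N, forall n, (N <= n)%N -> logn r (p n) = m
  | None => forall k, exists N, forall n, (N <= n)%N -> (k <= logn r (p n))%N
  end.

Definition torsion_free_scale (p : nat -> nat) : Prop :=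
  forall r, prime r -> vp_is p r (Some 0%N) \/ vp_is p r None.

Definition subsetZ (A : Type) := seqZ A -> Prop.

(* Orbit closure of u in the product topology: all x whose finite
   windows all occur in u. *)
Definition orbit_closure (A : Type) (u : seqZ A) : subsetZ A :=
  fun x => forall N : nat, exists k : int,
    forall i : int, `|i| <= N%:Z -> x i = u (i + k).

(* Continuity on X w.r.t. the product topology of discrete alphabets. *)
Definition continuous_on (A B : Type) (X : subsetZ A) (f : seqZ A -> seqZ B) : Prop :=
  forall x, X x -> forall N : nat, exists M : nat, forall y, X y ->
    (forall i : int, `|i| <= M%:Z -> y i = x i) ->
    (forall i : int, `|i| <= N%:Z -> f y i = f x i).

Definition maps_into (A : Type) (X : subsetZ A) (f : seqZ A -> seqZ A) : Prop :=
  forall x, X x -> X (f x).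

Definition homeo_of (A : Type) (X : subsetZ A) (f : seqZ A -> seqZ A) : Prop :=
  maps_into X f /\ continuous_on X f /\
  exists g, [/\ maps_into X g, continuous_on X g,
               forall x, X x -> g (f x) = x
             & forall x, X x -> f (g x) = x].

Definition aut_pow (A : Type) (X : subsetZ A) (n : nat) (f : seqZ A -> seqZ A) : Prop :=
  homeo_of X f /\ forall x, X x -> f (shiftn n x) = shiftn n (f x).

Definition aut_inf (A : Type) (X : subsetZ A) (f : seqZ A -> seqZ A) : Prop :=
  exists n : nat, (1 <= n)%N /\ aut_pow X n f.

Definition agree_on (A : Type) (X : subsetZ A) (f g : seqZ A -> seqZ A) : Prop :=
  forall x, X x -> f x = g x.

(* Aut^(oo)(X) and Aut^(oo)(Y) are isomorphic groups (group law: composition,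
   elements identified when they agree on the space). *)
Definition aut_inf_isomorphic (A B : Type) (X : subsetZ A) (Y : subsetZ B) : Prop :=
  exists Phi : (seqZ A -> seqZ A) -> (seqZ B -> seqZ B),
  [/\ forall f, aut_inf X f -> aut_inf Y (Phi f),
      forall f g, aut_inf X f -> aut_inf X g -> agree_on X f g -> agree_on Y (Phi f) (Phi g),
      forall f g, aut_inf X f -> aut_inf X g ->
        agree_on Y (Phi (fun x => f (g x))) (fun y => Phi f (Phi g y)),
      forall f g, aut_inf X f -> aut_inf X g -> agree_on Y (Phi f) (Phi g) -> agree_on X f g
    & forall h, aut_inf Y h -> exists f, aut_inf X f /\ agree_on Y (Phi f) h].

(* Main.v *)
(** Write [pi_n x] for the level of [x] in [Z / p n]. A prime [r] divides some [p n] if and only if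
  [Aut^(oo)] contains some [f <> 1] with [f^r = 1] such that the centralizer [C(f)] has no elements
  [g], [h] with [g^r], [h^r <> 1] and [g] commuting with every [C(f)]-conjugate of [h]. This
  condition is invariant under isomorphism, and a torsion-free scale is determined by the primes
  that divide it.

  If [f] commutes with [sigma^m], then [pi_n (f x) - pi_n x] depends only on [pi_n0 x], where [n0]
  is large enough for [gcd m (p n)] to be stable. So [f] permutes the [p n0] levels. If [f^r = 1] and
  [r] divides no [p n], then this permutation has a fixed level, and on a fixed level [f] is a
  translation of the odometer killed by [r], hence the identity. Thus the fixed set of [f] is clopen,
  nonempty and proper, and [sigma^m] restricted to it and to its complement gives [g] and [h].

  If [r] divides [p n1], let [f] add 1 to the last digit of the level modulo [r], without carry. It
  acts freely. Given [g] and [h], points alone in their fibre over the odometer are separated by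
  levels, so conjugating [h] by a power of [sigma] supported on a union of levels makes it fail to
  commute with [g]. *)

Require Import Defs.
From mathcomp Require Import all_boot all_algebra.
From mathcomp Require Import zify.
From Stdlib Require Import Classical ClassicalEpsilon FunctionalExtensionality.
Set Implicit Arguments. Unset Strict Implicit. Unset Printing Implicit Defensive.
Import GRing.Theory Num.Theory.
Local Open Scope ring_scope.

(** * Shifts, windows, and the group-theoretic property that detects a prime *)

Definition shz (A : Type) (j : int) (x : seqZ A) : seqZ A := fun i => x (i + j).

Definition agree (A : Type) (N : nat) (x y : seqZ A) : Prop :=
  forall i : int, `|i| <= N%:Z -> x i = y i.

Definition commute_on (A : Type) (X : subsetZ A) (f g : seqZ A -> seqZ A) : Prop :=
  forall x, X x -> f (g x) = g (f x).

Definition aut_inverse (A : Type) (X : subsetZ A) (k k' : seqZ A -> seqZ A) : Prop :=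
  [/\ aut_inf X k, aut_inf X k', forall x, X x -> k (k' x) = x
    & forall x, X x -> k' (k x) = x].

(** The last clause says that, in the centralizer of [f], no element with nontrivial [r]-th power
    commutes with the whole normal closure of another such element. Inverses are explicit and all
    equations hold on [X] only, as group elements are functions up to agreement there. *)
Definition has_free_element (A : Type) (X : subsetZ A) (r : nat) : Prop :=
  exists f, [/\ aut_inf X f,
    exists2 x, X x & f x <> x,
    forall x, X x -> iter r f x = x
  & forall g h, aut_inf X g -> aut_inf X h -> commute_on X f g -> commute_on X f h ->
      (exists2 x, X x & iter r g x <> x) -> (exists2 x, X x & iter r h x <> x) ->
      ~ forall k k', aut_inverse X k k' -> commute_on X f k ->
          commute_on X g (fun x => k (h (k' x)))].

(** * The group [aut_inf] of a shift-invariant set, and automorphisms built from shifts *)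

Section Automorphisms.
Variables (A : Type) (X : subsetZ A).
Implicit Types (f g h k : seqZ A -> seqZ A) (x y z : seqZ A).

Lemma shiftnE n x : shiftn n x = shz n%:Z x.
Proof. by []. Qed.

Lemma shz0 x : shz 0 x = x.
Proof. by apply: functional_extensionality => i; rewrite /shz addr0. Qed.

Lemma shzD i j x : shz i (shz j x) = shz (i + j) x.
Proof. by apply: functional_extensionality => l; rewrite /shz addrA. Qed.

Lemma agree_sym N x y : agree N x y -> agree N y x.
Proof. by move=> H i /H. Qed.

Lemma agree_trans N x y z : agree N x y -> agree N y z -> agree N x z.
Proof. by move=> H K i Hi; rewrite H ?K. Qed.

Lemma agree_le N M x y : (N <= M)%N -> agree M x y -> agree N x y.
Proof. by move=> le H i Hi; apply: H; lia. Qed.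

Hypothesis Xsh : forall j x, X x -> X (shz j x).

Lemma aut_inf_into f x : aut_inf X f -> X x -> X (f x).
Proof. by case=> n [_ [[H _] _]]; apply: H. Qed.

Lemma aut_inf_cont f : aut_inf X f -> continuous_on X f.
Proof. by case=> n [_ [[_ [H _]] _]]. Qed.

Lemma aut_inf_comm f : aut_inf X f -> exists2 m, (0 < m)%N &
  forall (j : int) x, X x -> f (shz (j * m%:Z) x) = shz (j * m%:Z) (f x).
Proof.
case=> m [m0 [[fX _] fm]]; exists m => //.
have pos (j : nat) x : X x -> f (shz (j%:Z * m%:Z) x) = shz (j%:Z * m%:Z) (f x).
  move=> Xx; elim: j => [|j IH]; first by rewrite mul0r !shz0.
  have E z : shz (j.+1%:Z * m%:Z) z = shiftn m (shz (j%:Z * m%:Z) z).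
    by rewrite shiftnE shzD; congr shz; lia.
  by rewrite !E fm ?IH //; apply: Xsh.
move=> j x Xx; case: (intP j) => [|n|n]; [exact: (pos 0%N)|exact: pos|].
(* For a negative multiple, [x] is written as the positive shift of its negative shift, and the
   positive case is applied to the latter. *)
rewrite -[in RHS](shz0 x) -[in RHS](_ : n.+1%:Z * m%:Z + - n.+1%:Z * m%:Z = 0); last by lia.
rewrite -shzD pos; last exact: Xsh.
by rewrite shzD (_ : - n.+1%:Z * m%:Z + n.+1%:Z * m%:Z = 0) ?shz0 //; lia.
Qed.

Lemma aut_inf_id : aut_inf X id.
Proof.
exists 1%N; split=> //; split=> //; split=> //; split; first by move=> x Xx N; exists N.
by exists id; split=> // x Xx N; exists N.
Qed.

Lemma continuous_on_comp f g : maps_into X g -> continuous_on X f -> continuous_on X g ->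
  continuous_on X (fun x => f (g x)).
Proof.
move=> gX cf cg x Xx N; have [M HM] := cf _ (gX _ Xx) N.
have [M' HM'] := cg _ Xx M; exists M' => y Xy /HM'; move/(_ Xy) => H.
by apply: HM => //; apply: gX.
Qed.

Lemma aut_inf_comp f g : aut_inf X f -> aut_inf X g -> aut_inf X (fun x => f (g x)).
Proof.
move=> Af Ag; have [m m0 fm] := aut_inf_comm Af; have [n n0 gn] := aut_inf_comm Ag.
case: Af Ag => [? [_ [[fX [cf [f' [f'X cf' f'f ff']]]] _]]].
move=> [? [_ [[gX [cg [g' [g'X cg' g'g gg']]]] _]]].
exists (n * m)%N; split; first by rewrite muln_gt0 n0.
split; last first.
  move=> x Xx; rewrite !shiftnE PoszM mulrC gn // mulrC fm //.
  exact: gX.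
split; first by move=> x /gX /fX.
split; first exact: continuous_on_comp.
exists (fun x => g' (f' x)); split; first by move=> x /f'X /g'X.
- exact: continuous_on_comp.
- by move=> x Xx; rewrite f'f ?g'g //; apply: gX.
- by move=> x Xx; rewrite gg' ?ff' //; apply: f'X.
Qed.

Lemma aut_inf_iter f n : aut_inf X f -> aut_inf X (iter n f).
Proof. by move=> Af; elim: n => [|n IH]; [exact: aut_inf_id|exact: (aut_inf_comp Af)]. Qed.

Lemma aut_inf_inv f : aut_inf X f -> exists f', aut_inverse X f f'.
Proof.
move=> Af; have := Af; case=> n [n0 [[fX [cf [f' [f'X cf' f'f ff']]]] fn]].
exists f'; split=> //; exists n; split=> //; split.
  by split=> //; split=> //; exists f.
move=> x Xx; rewrite -{1}[x]ff' // -fn ?f'f //; last exact: f'X.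
exact/(Xsh n%:Z)/f'X.
Qed.

Lemma aut_inverse_comp k k' l l' : aut_inverse X k k' -> aut_inverse X l l' ->
  aut_inverse X (fun x => k (l x)) (fun x => l' (k' x)).
Proof.
case=> Ak Ak' kk' k'k [Al Al' ll' l'l]; split; try exact: aut_inf_comp.
- by move=> x Xx; rewrite ll' ?kk' //; apply: aut_inf_into Ak' Xx.
- by move=> x Xx; rewrite k'k ?l'l //; apply: aut_inf_into Al Xx.
Qed.

Lemma aut_inverse_sym k k' : aut_inverse X k k' -> aut_inverse X k' k.
Proof. by case. Qed.

Lemma aut_inverse_id : aut_inverse X id id.
Proof. by split=> //; apply: aut_inf_id. Qed.

Lemma commute_on_inv f k k' : aut_inf X f -> aut_inverse X k k' ->
  commute_on X f k -> commute_on X f k'.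
Proof.
move=> Af [Ak Ak' kk' k'k] fk x Xx.
have Xk' := aut_inf_into Ak' Xx.
by rewrite -{2}[x]kk' // fk // k'k //; apply: aut_inf_into Af _.
Qed.

Lemma commute_on_comp f g h : aut_inf X h -> commute_on X f g -> commute_on X f h ->
  commute_on X f (fun x => g (h x)).
Proof.
move=> Ah fg fh x Xx.
by rewrite fg ?fh //; apply: aut_inf_into Ah Xx.
Qed.

Lemma iter_into f n x : aut_inf X f -> X x -> X (iter n f x).
Proof. by move=> Af Xx; elim: n => //= n; apply: aut_inf_into. Qed.

Lemma commute_on_iter f g n : aut_inf X g -> commute_on X f g -> commute_on X f (iter n g).
Proof.
by move=> Ag fg x Xx; elim: n => //= n IH; rewrite fg ?IH //; apply: iter_into.
Qed.

Lemma iter_agree f g n x : aut_inf X f -> agree_on X f g -> X x ->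
  iter n f x = iter n g x.
Proof.
move=> Af fg Xx; elim: n => //= n <-; apply: fg; exact: iter_into.
Qed.

(** A locally constant displacement gives a continuous map, and invariance of [c] under [shz m]
    makes the first map commute with [shz m]. The second map inherits commutation with a power of
    the shift by agreeing with the inverse of the first. *)
Lemma piecewise_shift_aut (c c' : seqZ A -> int) (m : nat) : (0 < m)%N ->
  (forall x, X x -> exists M, forall y, X y -> agree M y x -> c y = c x) ->
  (forall x, X x -> exists M, forall y, X y -> agree M y x -> c' y = c' x) ->
  (forall x, X x -> c (shz m%:Z x) = c x) ->
  (forall x, X x -> c' (shz (c x) x) = - c x) ->
  (forall x, X x -> c (shz (c' x) x) = - c' x) ->
  aut_inverse X (fun x => shz (c x) x) (fun x => shz (c' x) x).
Proof.
have cont (d : seqZ A -> int) :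
    (forall x, X x -> exists M, forall y, X y -> agree M y x -> d y = d x) ->
    continuous_on X (fun x => shz (d x) x).
  move=> dc x Xx N; have [M HM] := dc x Xx.
  exists (M + N + `|d x|)%N => y Xy Hy i Hi.
  have -> : d y = d x by apply: HM => //; apply: (agree_le _ Hy); lia.
  by apply: Hy; lia.
have into (d : seqZ A -> int) : maps_into X (fun x => shz (d x) x) by move=> x /Xsh.
move=> m0 cc cc' cm c'c c_c'.
have kk' x : X x -> shz (c (shz (c' x) x)) (shz (c' x) x) = x.
  by move=> Xx; rewrite shzD c_c' // addNr shz0.
have k'k x : X x -> shz (c' (shz (c x) x)) (shz (c x) x) = x.
  by move=> Xx; rewrite shzD c'c // addNr shz0.
suff Ac : aut_inf X (fun x => shz (c x) x).
  have [k [Ak Ak' fk kf]] := aut_inf_inv Ac.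
  split=> //; have := Ak'; case=> n [n0 [_ kn]]; exists n; split=> //; split.
    split; first exact: into; split; first exact: cont.
    by exists (fun x => shz (c x) x); split=> //; exact: cont.
  have E x : X x -> shz (c' x) x = k x.
    by move=> Xx; rewrite -[LHS]kf ?kk' //; apply: into.
  by move=> x Xx; rewrite !E ?kn //; apply: Xsh.
exists m; split=> //; split.
  split; first exact: into; split; first exact: cont.
  by exists (fun x => shz (c' x) x); split=> //; exact: cont.
by move=> x Xx; rewrite !shiftnE cm // !shzD addrC.
Qed.

(** A power of the shift supported on a clopen set that it preserves: the source of the commuting
    pair [g], [h] and of the separating automorphisms below. *)
Lemma partial_shift_aut (S : seqZ A -> bool) (m : nat) : (0 < m)%N ->
  (forall x, X x -> exists M, forall y, X y -> agree M y x -> S y = S x) ->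
  (forall x, X x -> S (shz m%:Z x) = S x) ->
  aut_inverse X (fun x => shz (if S x then m%:Z else 0) x)
                (fun x => shz (if S x then - m%:Z else 0) x).
Proof.
move=> m0 lc Sm.
have Sm' x : X x -> S (shz (- m%:Z) x) = S x.
  by move=> Xx; have := Sm _ (Xsh (- m%:Z) Xx); rewrite shzD subrr shz0.
have lc' (e : int) x : X x -> exists M, forall y, X y -> agree M y x ->
    (if S y then e else 0) = (if S x then e else 0).
  by move=> /lc[M HM]; exists M => y Xy /(HM _ Xy) ->.
apply: piecewise_shift_aut m0 (lc' _) (lc' _) _ _ _ => x Xx.
- by rewrite Sm.
- by case Sx: (S x); rewrite ?shz0 ?Sm ?Sx ?oppr0.
- by case Sx: (S x); rewrite ?shz0 ?Sm' ?Sx ?oppr0 ?opprK.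
Qed.

Lemma partial_shift_iter (S : seqZ A -> bool) (m n : nat) x :
  (forall x, X x -> S (shz m%:Z x) = S x) -> X x -> S x ->
  iter n (fun x => shz (if S x then m%:Z else 0) x) x = shz (n%:Z * m%:Z) x.
Proof.
move=> Sm Xx Sx.
suff [] : iter n (fun x => shz (if S x then m%:Z else 0) x) x = shz (n%:Z * m%:Z) x
    /\ S (shz (n%:Z * m%:Z) x) by [].
elim: n => [|n [IH SI]]; first by rewrite mul0r shz0.
have E : shz m%:Z (shz (n%:Z * m%:Z) x) = shz (n.+1%:Z * m%:Z) x.
  by rewrite shzD; congr shz; lia.
by rewrite iterS IH SI E; split=> //; rewrite -E Sm //; apply: Xsh.
Qed.

End Automorphisms.

(** * Invariance under group isomorphism *)

Section Transfer.
Variables (A B : Type) (X : subsetZ A) (Y : subsetZ B).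
Hypothesis Xsh : forall j x, X x -> X (shz j x).
Hypothesis Ysh : forall j x, Y x -> Y (shz j x).

Lemma aut_inf_isomorphic_sym : aut_inf_isomorphic X Y -> aut_inf_isomorphic Y X.
Proof.
case=> Phi [PA Pag PM Pinj Psurj].
(* A chosen preimage under [Phi], arbitrary outside [aut_inf Y]; injectivity of [Phi] makes the
   choice respect agreement and composition. *)
pose Psi h := epsilon (inhabits id) (fun f => aut_inf X f /\ agree_on Y (Phi f) h).
have PsiP h : aut_inf Y h -> aut_inf X (Psi h) /\ agree_on Y (Phi (Psi h)) h.
  by move=> /Psurj; apply: epsilon_spec.
exists Psi; split.
- by move=> h /PsiP [].
- move=> f g Af Ag fg; have [AF EF] := PsiP _ Af; have [AG EG] := PsiP _ Ag.
  by apply: Pinj => // x Yx; rewrite EF // EG // fg.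
- move=> f g Af Ag; have [AF EF] := PsiP _ Af; have [AG EG] := PsiP _ Ag.
  have [AH EH] := PsiP _ (aut_inf_comp Ysh Af Ag).
  apply: Pinj => //; first exact: aut_inf_comp.
  move=> x Yx; rewrite EH // (PM (Psi f) (Psi g)) // EG // EF //; exact: aut_inf_into Ag Yx.
- move=> f g Af Ag fg; have [AF EF] := PsiP _ Af; have [AG EG] := PsiP _ Ag.
  by move=> x Yx; rewrite -EF // -EG //; apply: Pag.
- move=> f Af; exists (Phi f); split; first exact: PA.
  by have [AF EF] := PsiP _ (PA _ Af); apply: Pinj.
Qed.

(** The property only involves composition and agreement on the space. The test elements [g'], [h']
    are pulled back by surjectivity, while the conjugators [k] are pushed forward. *)
Lemma has_free_element_transfer r :
  aut_inf_isomorphic X Y -> has_free_element X r -> has_free_element Y r.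
Proof.
case=> Phi [PA Pag PM Pinj Psurj] [f [Af [x0 Xx0 fx0] fr fP]].
(* [Phi id] is idempotent and invertible, hence the identity. *)
have Pid : agree_on Y (Phi id) id.
  have A1 := aut_inf_id X; have [k [Ak Ak' kk' k'k]] := aut_inf_inv Ysh (PA _ A1).
  move=> y Yy; have Yi := aut_inf_into (PA _ A1) Yy.
  by rewrite -[LHS]k'k // -(PM id id) // k'k.
have Piter g n : aut_inf X g -> agree_on Y (Phi (iter n g)) (iter n (Phi g)).
  move=> Ag; elim: n => [|n IH] y Yy; first exact: Pid.
  rewrite (PM g (iter n g)) //=; first by rewrite IH.
  exact: aut_inf_iter.
have Pcomm g h : aut_inf X g -> aut_inf X h ->
    commute_on Y (Phi g) (Phi h) -> commute_on X g h.
  move=> Ag Ah gh; apply: (Pinj (fun x => g (h x)) (fun x => h (g x)));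
    try exact: aut_inf_comp.
  by move=> y Yy; rewrite (PM g h) // (PM h g) // gh.
have Pcomm' g h : aut_inf X g -> aut_inf X h ->
    commute_on X g h -> commute_on Y (Phi g) (Phi h).
  move=> Ag Ah gh y Yy; rewrite -(PM g h) // -(PM h g) //.
  by apply: (Pag (fun x => g (h x)) (fun x => h (g x))) => //; exact: aut_inf_comp.
have Pmoved g : aut_inf X g -> (exists2 y, Y y & Phi g y <> y) -> exists2 x, X x & g x <> x.
  move=> Ag [y Yy gy]; apply: NNPP => H; apply: gy; rewrite -[RHS]Pid //.
  apply: Pag => //; first exact: aut_inf_id.
  by move=> x Xx; apply: NNPP => ?; apply: H; exists x.
exists (Phi f); split.
- exact: PA.
- apply: NNPP => H; apply: fx0; apply: (Pinj f id) => //; first exact: aut_inf_id.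
  by move=> y Yy; rewrite Pid //; apply: NNPP => ?; apply: H; exists y.
- move=> y Yy; rewrite -Piter // -[RHS]Pid //; apply: Pag => //.
  + exact: aut_inf_iter.
  + exact: aut_inf_id.
move=> g' h' Ag' Ah' fg fh gr hr H.
have [g [Ag Eg]] := Psurj _ Ag'; have [h [Ah Eh]] := Psurj _ Ah'.
have moved s s' : aut_inf X s -> aut_inf Y s' -> agree_on Y (Phi s) s' ->
    (exists2 y, Y y & iter r s' y <> y) -> exists2 x, X x & iter r s x <> x.
  move=> As As' E [y Yy sy]; apply: Pmoved; first exact: aut_inf_iter.
  by exists y; rewrite // Piter // (iter_agree r (PA _ As) E).
have cent s s' : aut_inf X s -> agree_on Y (Phi s) s' ->
    commute_on Y (Phi f) s' -> commute_on X f s.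
  move=> As E fs; apply: Pcomm => // y Yy; rewrite E // fs // E //.
  exact: aut_inf_into (PA _ Af) Yy.
apply: (fP g h) => //.
- exact: cent Eg fg.
- exact: cent Eh fh.
- exact: moved Eg gr.
- exact: moved Eh hr.
move=> k k' [Ak Ak' kk' k'k] fk; apply: Pcomm => //.
  by apply: aut_inf_comp => //; apply: aut_inf_comp.
have Ahk := aut_inf_comp Xsh Ah Ak'.
have E y : Y y -> Phi (fun x => k (h (k' x))) y = Phi k (h' (Phi k' y)).
  move=> Yy; rewrite (PM k (fun x => h (k' x))) // (PM h k') // Eh //.
  exact: aut_inf_into (PA _ Ak') Yy.
move=> y Yy; rewrite E // Eg; last first.
  apply: aut_inf_into (PA _ Ak) _; apply: aut_inf_into Ah' _.
  exact: aut_inf_into (PA _ Ak') Yy.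
rewrite E ?Eg //; last by apply: aut_inf_into Ag' Yy.
apply: (H (Phi k) (Phi k')) => //; last exact: Pcomm'.
have inv s s' : aut_inf X s -> aut_inf X s' -> (forall x, X x -> s (s' x) = x) ->
    forall y, Y y -> Phi s (Phi s' y) = y.
  move=> As As' E1 z Yz; rewrite -(PM s s') // -[RHS]Pid //.
  by apply: (Pag (fun x => s (s' x))) => //; [exact: aut_inf_comp|exact: aut_inf_id].
by split; [exact: PA|exact: PA|exact: inv|exact: inv].
Qed.

End Transfer.

(** * Finite choice, fixed points of maps of prime order, congruences *)

Lemma bounded_choice (P : nat -> nat -> Prop) (D : nat) :
  (forall d, (d < D)%N -> exists N, P d N) ->
  (forall d N M, (N <= M)%N -> P d N -> P d M) ->
  exists N, forall d, (d < D)%N -> P d N.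
Proof.
move=> + mono; elim: D => [|D IH] H; first by exists 0%N.
have [N HN] := IH (fun d dD => H d (ltnW dD)); have [M HM] := H D (ltnSn D).
exists (maxn N M) => d; rewrite ltnS leq_eqVlt => /orP[/eqP->|/HN].
  exact: mono (leq_maxr _ _) HM.
exact: mono (leq_maxl _ _).
Qed.

(** Without a fixed point every cycle of [s] has length exactly [r], so [r] divides the
    cardinality. *)
Lemma prime_order_fixpoint (T : finType) (s : T -> T) (r : nat) : prime r ->
  (forall x, iter r s x = x) -> ~~ (r %| #|T|)%N -> exists x, s x = x.
Proof.
move=> r_pr sr nr; apply: NNPP => nofix.
have s_inj : injective s.
  move=> x y xy; have r1 := ltn_predK (prime_gt0 r_pr).
  by rewrite -(sr x) -(sr y) -r1 !iterSr xy.
have ord x : fingraph.order s x = r.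
  pose o := fingraph.order s x; have o0 : (0 < o)%N := order_gt0 s x.
  have it q : iter (q * o) s x = x.
    by elim: q => // q IH; rewrite mulSn iterD IH iter_order.
  have : iter (r %% o) s x = x.
    by rewrite -[RHS]sr [in RHS](divn_eq r o) addnC iterD it.
  move/(congr1 (findex s x)); rewrite findex_iter ?ltn_pmod // findex0 => /eqP.
  rewrite -/(dvdn o r) => /(prime_nt_dvdP r_pr); apply.
  apply/eqP => o1; apply: nofix; exists x.
  by rewrite -[RHS](iter_order s_inj x) -/o o1.
move/negP: nr; apply; rewrite -(@fcard_order_set _ s s_inj r predT) ?dvdn_mull //.
by apply/subsetP => x _; rewrite inE ord.
Qed.

Lemma dvdz_congr (d a b c : int) : (d %| a - b)%Z -> (d %| a - c)%Z = (d %| b - c)%Z.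
Proof. by move=> ab; rewrite -[a - c](subrKA b) rpredDl. Qed.

(** * Levels of a Toeplitz subshift and the action of automorphisms on them *)

Section Levels.
Variables (A : Type) (u : seqZ A) (p : nat -> nat).
Hypothesis ps : period_structure u p.
Hypothesis aperiodic : ~ exists m : nat, (0 < m)%N /\ forall n : int, u n = u (n + m%:Z).
Let X := orbit_closure u.
Implicit Types (x y z : seqZ A) (n m : nat) (a b i j k : int).

Lemma p_gt0 n : (0 < p n)%N. Proof. by case: ps. Qed.

Lemma p_dvd n m : (n <= m)%N -> (p n %| p m)%N.
Proof.
case: ps => _ H _ _; elim: m => [|m IH]; first by rewrite leqn0 => /eqP->.
by rewrite leq_eqVlt => /orP[/eqP->//|/IH/dvdn_trans]; apply.
Qed.

(** If every [p n] were at most [M], each would divide [M!], which would then be a period of [u]. *)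
Lemma p_unbounded M : exists n, (M < p n)%N.
Proof.
apply: NNPP => H; apply: aperiodic; exists M`!; split; first exact: fact_gt0.
move=> k; case: ps => _ _ /(_ k)[n Hn] _.
have /dvdnP[q ->] : (p n %| M`!)%N.
  apply: dvdn_fact; rewrite p_gt0 leqNgt; apply/negP => ?; apply: H; by exists n.
by rewrite (Hn q) mulnC PoszM.
Qed.

Lemma orbit_closure_shz j x : X x -> X (shz j x).
Proof.
move=> Xx N; have [k Hk] := Xx (N + `|j|)%N; exists (j + k) => i Hi.
by rewrite /shz Hk ?addrA //; lia.
Qed.

Lemma orbit_closure_orbit k : X (shz k u).
Proof. by move=> N; exists k. Qed.

Lemma orbit_closureP x : X x -> forall N, exists k, agree N x (shz k u).
Proof. exact. Qed.

(* Otherwise the [p n]-skeleton would be invariant under translation by [gcd (p n) d], against essentiality. *)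
Lemma skeleton_not_invariant n d : ~~ (p n %| d)%Z ->
  exists i l m, [/\ (0 < m)%N, per u (p n) i
    & forall j, u (i + d + (p n)%:Z * (l + m%:Z * j)) <> u i].
Proof.
move=> nd; apply: NNPP => H.
have inv i : per u (p n) i -> forall l, u (i + d + (p n)%:Z * l) = u i.
  move=> pi l; apply: NNPP => ne; apply: H.
  case: ps => _ _ /(_ (i + d + (p n)%:Z * l))[n' Hn'] _.
  exists i, l, (p n'); split=> // [|j]; first exact: p_gt0.
  move: (Hn' ((p n)%:Z * j)) ne; set s := u _ => Hs.
  rewrite (_ : i + _ + _ = i + d + (p n)%:Z * l + (p n')%:Z * ((p n)%:Z * j)); last by lia.
  by rewrite -Hs.
have inv' c i : per u (p n) i -> forall l, u (i + c%:Z * d + (p n)%:Z * l) = u i.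
  elim: c i => [|c IH] i pi l; first by rewrite mul0r addr0 -pi.
  have pid : per u (p n) (i + d) by move=> e; rewrite inv // -(inv i pi 0) mulr0 addr0.
  rewrite (_ : i + _ + _ = i + d + c%:Z * d + (p n)%:Z * l); last by lia.
  by rewrite IH // -(inv i pi 0) mulr0 addr0.
have p0 := p_gt0 n; pose g := gcdn (p n) `|d|%N.
have g0 : (0 < g)%N by rewrite gcdn_gt0 p0.
have gp : (g < p n)%N.
  rewrite ltn_neqAle dvdn_leq ?dvdn_gcdl // andbT; apply: contra nd => /eqP E.
  by rewrite dvdzE /= -E dvdn_gcdr.
case: ps => _ _ _ /(_ n g g0 gp); apply=> k; split=> [gk e|pk e].
  have /dvdnP[q ->] : (g %| p n)%N by apply: dvdn_gcdl.
  by rewrite mulnC PoszM -mulrA -gk.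
have [a [b Eg]] := Bezoutz d (p n).
have {}Eg : g%:Z = a * d + b * (p n)%:Z by rewrite Eg /gcdz /= /g gcdnC.
(* [inv'] takes a natural number of steps [d], so the coefficient [a * e] is reduced modulo [p n];
   the excess is absorbed into the multiple of [p n]. *)
have E1 : 0 <= ((a * e) %% (p n))%Z by apply: modz_ge0; lia.
have E2 := divz_eq (a * e) (p n).
have E3 : a * e * d = ((a * e %/ p n)%Z * (p n)%:Z + (a * e %% p n)%Z) * d by rewrite -E2.
have := inv' `|(a * e %% p n)%Z|%N k pk ((a * e %/ p n)%Z * d + b * e).
by rewrite gez0_abs // => <-; congr (u _); rewrite Eg; lia.
Qed.

(** For each nonzero residue [d] of [k' - k], [skeleton_not_invariant] yields an arithmetic
    progression of positions where the two shifts of [u] differ. A window as long as its step meets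
    it, and there are finitely many [d]. *)
Lemma window_determines_level n :
  exists N, forall k k', agree N (shz k u) (shz k' u) -> (p n %| k - k')%Z.
Proof.
have p0 := p_gt0 n.
pose P d N := ~~ (p n %| d)%N ->
  forall k k' e, k' - k = d%:Z + (p n)%:Z * e -> ~ agree N (shz k u) (shz k' u).
have [|d N M NM H nd k k' e E /(agree_le NM)|N HN] := @bounded_choice P (p n).
- move=> d _; case: (boolP (p n %| d)%N) => [dd|nd]; first by exists 0%N; rewrite /P dd.
  have [i [l [m [m0 pi ne]]]] := @skeleton_not_invariant n d nd.
  exists (p n * m)%N => _ k k' e E ag.
  have M0 : (p n * m)%:Z != 0 by lia.
  pose s := i + (p n)%:Z * (l - e) - k.
  have Es := divz_eq s (p n * m)%N.
  have r0 := @modz_ge0 s _ M0; have rm := @ltz_mod s _ M0.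
  pose j := - (s %/ (p n * m)%N)%Z.
  have Ej : s + (p n * m)%:Z * j = (s %% (p n * m)%N)%Z by rewrite /j {1}Es; lia.
  have Hu : shz k u (s + (p n * m)%:Z * j) = shz k' u (s + (p n * m)%:Z * j).
    by apply: ag; rewrite Ej; lia.
  rewrite /shz in Hu; apply: (ne j); rewrite (pi (l - e + m%:Z * j)).
  have -> : i + d%:Z + (p n)%:Z * (l + m%:Z * j) = s + (p n * m)%:Z * j + k'.
    by rewrite (_ : k' = k + (d%:Z + (p n)%:Z * e)) /s; lia.
  by rewrite -Hu; congr (u _); rewrite /s; lia.
- exact: H E.
exists N => k k' ag; apply: contraT => nd.
have dm0 := @modz_ge0 (k' - k) (p n) ltac:(lia).
have dmp := @ltz_mod (k' - k) (p n) ltac:(lia).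
have E := divz_eq (k' - k) (p n).
exfalso; apply: (HN `|(k' - k) %% p n|%Z%N _ _ k k' ((k' - k) %/ p n)%Z _ ag); first by lia.
  apply: contra nd => dd; rewrite -opprB rpredN E rpredD ?dvdz_mull //.
by lia.
Qed.

(** Levels are integers meaningful only modulo [p n], so statements about them are
    divisibilities. *)
Definition has_level n k x : Prop :=
  forall N, exists k', (p n %| k' - k)%Z /\ agree N x (shz k' u).

(* The image of [x] in [Z / p n]: the level of the Toeplitz tower containing [x]. *)
Definition phase n x : int := epsilon (inhabits 0) (fun k => has_level n k x).

Lemma phaseP n x : X x -> has_level n (phase n x) x.
Proof.
move=> Xx; apply: (@epsilon_spec int (inhabits 0) (fun k => has_level n k x)).
have [N HN] := window_determines_level n.
have [k Hk] := orbit_closureP Xx N; exists k => M.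
have [k' Hk'] := orbit_closureP Xx (N + M); exists k'.
split; last by apply: agree_le Hk'; lia.
apply: HN; apply: agree_trans Hk; apply: agree_sym; apply: agree_le Hk'; lia.
Qed.

Lemma phase_window_unif n : exists N, forall x k, X x -> agree N x (shz k u) ->
  (p n %| phase n x - k)%Z.
Proof.
have [N HN] := window_determines_level n; exists N => x k Xx xk.
have [k' [/dvdzP[q kk'] xk']] := phaseP n Xx N.
have /dvdzP[q' E] := HN k' k (agree_trans (agree_sym xk') xk).
by apply/dvdzP; exists (q' - q); lia.
Qed.

Lemma phase_locally_constant n x : X x -> exists M, forall y, X y -> agree M y x ->
  (p n %| phase n y - phase n x)%Z.
Proof.
move=> Xx; have [N HN] := phase_window_unif n; exists N => y Xy yx.
have [k xk] := orbit_closureP Xx N.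
have /dvdzP[q E] := HN _ _ Xx xk.
have /dvdzP[q' E'] := HN _ _ Xy (agree_trans yx xk).
by apply/dvdzP; exists (q' - q); lia.
Qed.

Lemma phase_shz n j x : X x -> (p n %| phase n (shz j x) - (phase n x + j))%Z.
Proof.
move=> Xx; have [N HN] := phase_window_unif n.
have [k xk] := orbit_closureP Xx (N + `|j|).
have /dvdzP[q E] : (p n %| phase n x - k)%Z by apply: HN => //; apply: agree_le xk; lia.
have /dvdzP[q' E'] : (p n %| phase n (shz j x) - (k + j))%Z.
  apply: HN; first exact: orbit_closure_shz.
  by move=> i Hi; rewrite /shz xk /shz; [congr u; lia|lia].
by apply/dvdzP; exists (q' - q); lia.
Qed.

Lemma phase_shz_period n x : X x -> (p n %| phase n (shz (p n)%:Z x) - phase n x)%Z.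
Proof.
by move=> /(phase_shz n (p n)%:Z)/dvdzP[q E]; apply/dvdzP; exists (q + 1); lia.
Qed.

Lemma phase_orbit n k : (p n %| phase n (shz k u) - k)%Z.
Proof. by have [N HN] := phase_window_unif n; apply: HN => //; apply: orbit_closure_orbit. Qed.

Lemma phase_le n m x k : (n <= m)%N -> X x -> (p m %| phase m x - k)%Z ->
  (p n %| phase n x - k)%Z.
Proof.
move=> nm Xx /dvdzP[q E]; have /dvdnP[e Ee] := p_dvd nm.
have [N HN] := phase_window_unif n; have [N' HN'] := phase_window_unif m.
have [l xl] := orbit_closureP Xx (maxn N N').
have /dvdzP[q' E'] := HN _ _ Xx (agree_le (leq_maxl _ _) xl).
have /dvdzP[q'' E''] := HN' _ _ Xx (agree_le (leq_maxr _ _) xl).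
apply/dvdzP; exists (q' + (q - q'') * e%:Z); rewrite Ee PoszM in E E''; lia.
Qed.

Lemma phase_le_eq n m x y : (n <= m)%N -> X x -> X y -> (p m %| phase m x - phase m y)%Z ->
  (p n %| phase n x - phase n y)%Z.
Proof.
move=> nm Xx Xy /(phase_le nm Xx)/dvdzP[q E].
have /dvdzP[q' E'] : (p n %| phase n y - phase m y)%Z.
  by apply: phase_le nm Xy _; rewrite subrr dvdz0.
by apply/dvdzP; exists (q - q'); lia.
Qed.

Lemma phase_value n x k i : X x -> (p n %| phase n x - k)%Z -> per u (p n) (i + k) ->
  x i = u (i + k).
Proof.
move=> Xx /dvdzP[q E] pik.
have [k' [/dvdzP[q' E'] xk']] := phaseP n Xx `|i|%N.
rewrite xk'; last by lia.
by rewrite (pik (q' + q)) /shz; congr u; lia.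
Qed.

(** For large [n] the whole window lies in the [p n]-skeleton, where the level determines the
    symbol. *)
Lemma phase_determines_window N k : exists n, forall x, X x ->
  (p n %| phase n x - k)%Z -> agree N x (shz k u).
Proof.
pose P (d n : nat) := per u (p n) (d%:Z - N%:Z + k).
have [d _|d n m nm H e|n Hn] := @bounded_choice P (N + N).+1.
- by case: ps => _ _ H _; apply: H.
- by have /dvdnP[q ->] := p_dvd nm; rewrite mulnC PoszM -mulrA -H.
exists n => x Xx xk i Hi; apply: (phase_value Xx xk).
rewrite (_ : i + k = (absz (i + N%:Z))%:Z - N%:Z + k); last by lia.
by apply: Hn; lia.
Qed.

(** The shift adds [j] to levels, so [p n] divides [j]; a [p n] larger than [|j|] leaves only
    zero. *)
Lemma shz_fixed j x : X x -> shz j x = x -> j = 0.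
Proof.
move=> Xx jx; have [n Hn] := p_unbounded `|j|%N.
have := phase_shz n j Xx; rewrite jx => /dvdzP[q E].
have [q0|q0] := eqVneq q 0.
  by rewrite q0 in E; lia.
have : `|j| = `|q| * (p n)%:Z by lia.
have : 1 <= `|q| by lia.
by nia.
Qed.

(* [x] is alone in its fibre over the odometer. *)
Definition regular x : Prop :=
  X x /\ forall y, X y -> (forall n, (p n %| phase n y - phase n x)%Z) -> y = x.

Lemma regular_orbit k : regular (shz k u).
Proof.
split=> [|y Xy H]; first exact: orbit_closure_orbit.
apply: functional_extensionality => i.
case: ps => _ _ /(_ (i + k))[n Hn] _; apply: phase_value Xy _ Hn.
by have /dvdzP[q E] := H n; have /dvdzP[q' E'] := phase_orbit n k;
  apply/dvdzP; exists (q + q'); lia.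
Qed.

(** One [k] serves the point, its image and its level, since a single large window controls all
    three. *)
Lemma orbit_approximation f x N n : aut_inf X f -> X x -> exists k,
  [/\ agree N x (shz k u), agree N (f x) (f (shz k u)) & (p n %| phase n x - k)%Z].
Proof.
move=> Af Xx; have [M HM] := aut_inf_cont Af Xx N.
have [N' HN'] := phase_window_unif n.
have [k xk] := orbit_closureP Xx (N + M + N'); exists k; split.
- by apply: agree_le xk; lia.
- move=> i Hi; symmetry; apply: HM => //; first exact: orbit_closure_orbit.
  by apply: agree_sym; apply: agree_le xk; lia.
- by apply: HN' => //; apply: agree_le xk; lia.
Qed.

Lemma fixed_orbit_fixed f x : aut_inf X f -> (forall k, f (shz k u) = shz k u) ->
  X x -> f x = x.
Proof.
move=> Af fu Xx; apply: functional_extensionality => i.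
have [k [xk fxk _]] := orbit_approximation `|i|%N 0 Af Xx.
by rewrite fxk ?xk ?fu //; lia.
Qed.

(** The gcds are at most [m], so finitely many values occur, and dividing [p n] persists as [n]
    grows. *)
Lemma gcd_stable m : (0 < m)%N -> exists n0, forall n, (gcdn m (p n) %| p n0)%N.
Proof.
move=> m0; pose P g N := (exists n, (g %| p n)%N) -> (g %| p N)%N.
have [g _|g N M NM H /H|n0 H] := @bounded_choice P m.+1.
- by case: (classic (exists n, (g %| p n)%N)) => [[n gn]|ng]; [exists n|exists 0%N].
- by move/dvdn_trans; apply; apply: p_dvd.
exists n0 => n; apply: H; last by exists n; apply: dvdn_gcdr.
by rewrite ltnS dvdn_leq ?dvdn_gcdl.
Qed.

(* [f] commutes with [shz m]; the [shz m]-orbit of an orbit point [shz a u] accumulates at every [shz b u]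
   with [b = a] modulo the stable value of [gcd m (p n)]. *)
Lemma phase_cocycle f : aut_inf X f -> exists n0, forall n x y, X x -> X y ->
  (p n0 %| phase n0 x - phase n0 y)%Z ->
  (p n %| (phase n (f x) - phase n x) - (phase n (f y) - phase n y))%Z.
Proof.
move=> Af; have [m m0 fm] := aut_inf_comm orbit_closure_shz Af.
have [n0 Hn0] := gcd_stable m0; exists n0 => n x y Xx Xy xy.
have Xf z : X z -> X (f z) by apply: aut_inf_into.
(* Reduction to orbit points: [shz k u] has the level of [z] and is translated by [f] by the same
   amount. *)
have near z : X z -> exists k, (p n0 %| phase n0 z - k)%Z /\
    (p n %| (phase n (f z) - phase n z) - (phase n (f (shz k u)) - k))%Z.
  move=> Xz; have [M HM] := phase_locally_constant n (Xf _ Xz).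
  have [k [zk fzk ph]] := orbit_approximation M (maxn n n0) Af Xz; exists k; split.
    exact: phase_le (leq_maxr _ _) Xz ph.
  have /dvdzP[q E] := phase_le (leq_maxl _ _) Xz ph.
  have /dvdzP[q' E'] := HM _ (Xf _ (orbit_closure_orbit k)) (agree_sym fzk).
  by apply/dvdzP; exists (- q - q'); lia.
have [a [/dvdzP[qa Ea] /dvdzP[qa' Ea']]] := near _ Xx.
have [b [/dvdzP[qb Eb] /dvdzP[qb' Eb']]] := near _ Xy.
have Xu k := orbit_closure_orbit k.
suff /dvdzP[q E] : (p n %| (phase n (f (shz a u)) - a) - (phase n (f (shz b u)) - b))%Z.
  by apply/dvdzP; exists (q + qa' - qb'); lia.
have [M HM] := phase_locally_constant n (Xf _ (Xu b)).
have [M' HM'] := aut_inf_cont Af (Xu b) M.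
have [n' Hn'] := phase_determines_window M' b.
have /dvdzP[e Ee] : (gcdn m (p (maxn n n')) %| b - a)%Z.
  move: xy => /dvdzP[q E]; have /dvdnP[c Ec] := Hn0 (maxn n n').
  apply/dvdzP; exists ((qa - q - qb) * c%:Z); rewrite -mulrA -PoszM -Ec; lia.
(* Bezout gives a multiple [j * m] with [a + j * m] equal to [b] modulo [p (maxn n n')]: [n'] brings
   the shifted point near [shz b u], and [n] is where levels are compared. *)
have [s [t Est]] := Bezoutz m (p (maxn n n')).
have Eba : a + (e * s) * m%:Z = b - e * t * (p (maxn n n'))%:Z.
  have : b - a = e * (s * m%:Z + t * (p (maxn n n'))%:Z) by rewrite Est.
  by lia.
pose j : int := e * s; rewrite -/j in Eba.
have Ebn : (p (maxn n n') %| phase (maxn n n') (shz (a + j * m%:Z) u) - b)%Z.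
  have /dvdzP[q E] := phase_orbit (maxn n n') (a + j * m%:Z).
  by apply/dvdzP; exists (q - e * t); lia.
have ag := Hn' _ (Xu _) (phase_le (leq_maxr _ _) (Xu _) Ebn).
have /dvdzP[q1 E1] := HM _ (Xf _ (Xu _)) (HM' _ (Xu _) ag).
have /dvdzP[q2 E2] :
    (p n %| phase n (f (shz (a + j * m%:Z) u)) - (phase n (f (shz a u)) + j * m%:Z))%Z.
  rewrite (addrC a) -shzD fm //; exact: phase_shz (Xf _ (Xu a)).
have /dvdzP[q3 E3] := phase_le (leq_maxl _ _) (Xu _) Ebn.
have /dvdzP[q4 E4] := phase_orbit n (a + j * m%:Z).
by apply/dvdzP; exists (q1 - q2 + q4 - q3); lia.
Qed.

(** By the cocycle property the inverse of [f] sends points with the levels of [f x] to points with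
    the levels of [x], and [x] is the only one. *)
Lemma regular_aut f x : aut_inf X f -> regular x -> regular (f x).
Proof.
move=> Af [Xx rx]; split=> [|y Xy ph]; first exact: aut_inf_into Af Xx.
have [k [_ Ak fk kf]] := aut_inf_inv orbit_closure_shz Af.
have [n0 Hn0] := phase_cocycle Ak.
rewrite -[y]fk //; congr f; apply: rx; first exact: aut_inf_into Ak Xy.
move=> n; have Xfx := aut_inf_into Af Xx.
have /dvdzP[q E] := Hn0 n _ _ Xy Xfx (ph n0).
have /dvdzP[q' E'] := ph n.
by rewrite kf // in E; apply/dvdzP; exists (q + q'); lia.
Qed.

Lemma phase_aut_locally_constant f n x : aut_inf X f -> X x ->
  exists M, forall y, X y -> agree M y x ->
    (p n %| (phase n (f y) - phase n y) - (phase n (f x) - phase n x))%Z.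
Proof.
move=> Af Xx; have [M HM] := phase_locally_constant n (aut_inf_into Af Xx).
have [M' HM'] := aut_inf_cont Af Xx M; have [N HN] := phase_locally_constant n Xx.
exists (maxn M' N) => y Xy yx.
have /dvdzP[q E] := HN _ Xy (agree_le (leq_maxr _ _) yx).
have /dvdzP[q' E'] := HM _ (aut_inf_into Af Xy) (HM' _ Xy (agree_le (leq_maxl _ _) yx)).
by apply/dvdzP; exists (q' - q); lia.
Qed.

(** * A prime that divides no period *)

Section NoFreeElement.
Variable r : nat.
Hypothesis r_pr : prime r.
Hypothesis rp : forall n, ~~ (r %| p n)%N.

(* The translation cocycle is constant along the [f]-orbit, so [r] times it vanishes in [Z / p n]. *)
Lemma level_fixed f n0 : aut_inf X f -> (forall x, X x -> iter r f x = x) ->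
  (forall n x y, X x -> X y -> (p n0 %| phase n0 x - phase n0 y)%Z ->
    (p n %| (phase n (f x) - phase n x) - (phase n (f y) - phase n y))%Z) ->
  forall x, X x -> (p n0 %| phase n0 (f x) - phase n0 x)%Z -> f x = x.
Proof.
move=> Af fr coc.
have Xf x : X x -> X (f x) by apply: aut_inf_into.
have reg x : regular x -> (p n0 %| phase n0 (f x) - phase n0 x)%Z -> f x = x.
  move=> [Xx rx] fx; apply: rx => [|n]; first exact: Xf.
  have it (i : nat) : (p n0 %| phase n0 (iter i f x) - phase n0 x)%Z /\
      (p n %| phase n (iter i f x) - phase n x - i%:Z * (phase n (f x) - phase n x))%Z.
    elim: i => [|i [/dvdzP[q IH] /dvdzP[q' IH']]].
      by rewrite !subrr mul0r subrr !dvdz0.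
    have Xi := iter_into i Af Xx.
    have d0 : (p n0 %| phase n0 (iter i f x) - phase n0 x)%Z by apply/dvdzP; exists q.
    have /dvdzP[e E] := coc n0 _ _ Xi Xx d0; have /dvdzP[e' E'] := coc n _ _ Xi Xx d0.
    move/dvdzP: fx => [s Es]; rewrite iterS; split.
      by apply/dvdzP; exists (e + s + q); lia.
    by apply/dvdzP; exists (e' + q'); lia.
  have [_] := it r; rewrite fr // subrr sub0r rpredN.
  rewrite !dvdzE abszM Gauss_dvdr // coprime_sym prime_coprime //; exact: rp.
(* A general point is approximated by orbit points of the same level; these are regular, and the
   cocycle property shows that [f] fixes their level too. *)
move=> x Xx fx; apply: functional_extensionality => i.
have [k [xk fxk ph]] := orbit_approximation `|i|%N n0 Af Xx.
have ii : `|i| <= `|i|%N%:Z by lia.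
rewrite fxk // xk // reg //; first exact: regular_orbit.
have /dvdzP[q0 E0] := ph; have /dvdzP[q1 E1] := phase_orbit n0 k.
have Xk := orbit_closure_orbit k.
have [|q E] := @dvdzP _ _ (coc n0 _ _ Xk Xx _).
  by apply/dvdzP; exists (q1 - q0); lia.
by move/dvdzP: fx => [s Es]; apply/dvdzP; exists (q + s); lia.
Qed.

(** By the cocycle property [f] induces a map of the [p n0] levels with trivial [r]-th iterate, and
    [r] does not divide their number. *)
Lemma level_fixed_exists f n0 : aut_inf X f -> (forall x, X x -> iter r f x = x) ->
  (forall n x y, X x -> X y -> (p n0 %| phase n0 x - phase n0 y)%Z ->
    (p n %| (phase n (f x) - phase n x) - (phase n (f y) - phase n y))%Z) ->
  exists2 x, X x & (p n0 %| phase n0 (f x) - phase n0 x)%Z.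
Proof.
move=> Af fr coc; case Ep : (p n0) => [|D]; first by have := p_gt0 n0; rewrite Ep.
pose lev x : 'I_D.+1 := inord `|(phase n0 x %% p n0)%Z|%N.
have p0 : (p n0)%:Z != 0 by rewrite Ep.
have levE x : (lev x)%:Z = (phase n0 x %% p n0)%Z.
  have ge0 := @modz_ge0 (phase n0 x) _ p0; have lt := @ltz_mod (phase n0 x) _ p0.
  by rewrite /lev inordK; lia.
have lev_eq x y : lev x = lev y -> (p n0 %| phase n0 x - phase n0 y)%Z.
  by move/(congr1 (fun k : 'I_D.+1 => k%:Z)); rewrite !levE => /eqP; rewrite eqz_mod_dvd.
have eq_lev x y : (p n0 %| phase n0 x - phase n0 y)%Z -> lev x = lev y.
  by rewrite -eqz_mod_dvd => /eqP E; rewrite /lev E.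
have levK (k : 'I_D.+1) : lev (shz k%:Z u) = k.
  apply/val_inj/eqP; rewrite -eqz_nat levE; have := phase_orbit n0 k.
  rewrite -eqz_mod_dvd => /eqP->; rewrite modz_small //.
  by rewrite Ep; have := ltn_ord k; lia.
pose s (k : 'I_D.+1) := lev (f (shz k%:Z u)).
have Xk k := orbit_closure_orbit k.
have levf x : X x -> lev (f x) = s (lev x).
  move=> Xx; apply: eq_lev.
  have d0 : (p n0 %| phase n0 x - phase n0 (shz (lev x)%:Z u))%Z.
    by apply: lev_eq; rewrite levK.
  have /dvdzP[q E] := coc n0 _ _ Xx (Xk _) d0; move/dvdzP: d0 => [q' E'].
  by apply/dvdzP; exists (q + q'); lia.
have [||k sk] := @prime_order_fixpoint 'I_D.+1 s r r_pr.
- move=> k; have it (i : nat) : lev (iter i f (shz k%:Z u)) = iter i s k.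
    by elim: i => [|i IH]; rewrite ?levK //= levf ?IH //; exact: (iter_into i Af (Xk _)).
  by rewrite -it fr ?levK.
- by rewrite card_ord -Ep; apply: rp.
by rewrite -Ep; exists (shz k%:Z u) => //; apply: lev_eq; rewrite levK -/(s k).
Qed.

(** The fixed set [S] of [f] is cut out by a condition on levels, hence clopen. The centralizer
    preserves it, so [g] moves points of [S] only and every conjugate of [h] moves points outside
    [S] only. *)
Lemma no_free_element : ~ has_free_element X r.
Proof.
case=> f [Af [x1 Xx1 fx1] fr fP].
have Xsh := orbit_closure_shz.
have [n0 coc] := phase_cocycle Af; have fixS := level_fixed Af fr coc.
have [x0 Xx0 Sx0] := level_fixed_exists Af fr coc.
have [m m0 fm] := aut_inf_comm Xsh Af.
have {}fm x : X x -> f (shz m%:Z x) = shz m%:Z (f x).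
  by move=> Xx; have := fm 1 x Xx; rewrite mul1r.
have Xf x : X x -> X (f x) by apply: aut_inf_into.
have f_inj x y : X x -> X y -> f x = f y -> x = y.
  by have [k [_ _ _ kf]] := aut_inf_inv Xsh Af; move=> Xx Xy E; rewrite -(kf x) // E kf.
pose S x := (p n0 %| phase n0 (f x) - phase n0 x)%Z.
have SP x : X x -> reflect (f x = x) (S x).
  move=> Xx; apply: (iffP idP); first exact: fixS.
  by move=> E; rewrite /S E subrr dvdz0.
have Slc x : X x -> exists M, forall y, X y -> agree M y x -> S y = S x.
  move=> Xx; have [M HM] := phase_aut_locally_constant n0 Af Xx; exists M => y Xy yx.
  by have := dvdz_congr 0 (HM y Xy yx); rewrite !subr0.
have Sm x : X x -> S (shz m%:Z x) = S x.
  move=> Xx; apply/(SP _ (Xsh _ _ Xx))/(SP _ Xx) => [|E]; rewrite fm //; last by rewrite E.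
  by move/(congr1 (shz (- m%:Z))); rewrite !shzD addNr !shz0.
have Sf x : X x -> S (f x) = S x.
  move=> Xx; apply/(SP _ (Xf _ Xx))/(SP _ Xx) => [E|E]; last by rewrite !E.
  by apply: f_inj E => //; apply: Xf.
have moved : forall (T : seqZ A -> bool) x, X x -> T x -> (forall z, X z -> T (shz m%:Z z) = T z) ->
    exists2 z, X z & iter r (fun z => shz (if T z then m%:Z else 0) z) z <> z.
  move=> T x Xx Tx Tm; exists x => //; rewrite (partial_shift_iter Xsh) //.
  by move/(shz_fixed Xx)/eqP; rewrite mulf_eq0; have := prime_gt0 r_pr; lia.
have cent (T : seqZ A -> bool) : (forall x, X x -> T (f x) = T x) ->
    commute_on X f (fun x => shz (if T x then m%:Z else 0) x).
  by move=> Tf x Xx; rewrite Tf //; case: ifP; rewrite ?shz0 ?fm.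
have [Ag _ _ _] := partial_shift_aut Xsh m0 Slc Sm.
have NSm x : X x -> ~~ S (shz m%:Z x) = ~~ S x by move=> /Sm->.
have [|Ah _ _ _] := @partial_shift_aut A X Xsh (fun x => ~~ S x) m m0 _ NSm.
  by move=> x /Slc[M HM]; exists M => y Xy /(HM y Xy)->.
apply: (fP _ _ Ag Ah).
- exact: cent.
- by apply: (cent (fun x => ~~ S x)) => x /Sf->.
- exact: moved Sx0 Sm.
- by apply: (moved (fun x => ~~ S x) x1) => //; apply/(SP _ Xx1).
move=> k k' Ik fk; have [Ak Ak' kk' k'k] := Ik.
have fk' := commute_on_inv Af Ik fk.
have Sk l x : aut_inf X l -> commute_on X f l -> X x -> S x -> S (l x).
  move=> Al fl Xx /(SP _ Xx) fx; apply/(SP _ (aut_inf_into Al Xx)).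
  by rewrite fl // fx.
have Xk' x : X x -> X (k' x) by apply: aut_inf_into.
have Xk x : X x -> X (k x) by apply: aut_inf_into.
have Sk' x : X x -> S (k' x) = S x.
  move=> Xx; apply/idP/idP; last exact: Sk.
  by move/(Sk k); rewrite kk' //; apply=> //; apply: Xk'.
have SkE x : X x -> S (k x) = S x.
  by move=> Xx; rewrite -{2}(k'k x) // Sk' //; apply: Xk.
move=> x Xx; rewrite Sk' //; case: (boolP (S x)) => Sx /=.
  by rewrite shz0 kk' // Sx Sk' ?Sm ?Sx /= ?shz0 ?kk' //; apply: Xsh.
rewrite shz0 Sk' // Sx /= SkE ?NSm; last exact/Xsh/Xk'.
by rewrite Sm ?Sk' ?(negPf Sx) ?shz0 //; apply: Xk'.
Qed.

End NoFreeElement.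

(** * A prime that divides some period *)

Section FreeElement.
Variables (r n1 : nat).
Hypothesis r_pr : prime r.
Hypothesis rp : (r %| p n1)%N.

(* [cycle i] adds [i] to the last digit of the level, modulo [r] and without carry. *)
Definition cycle_shift i x : int := ((phase n1 x + i) %% r)%Z - (phase n1 x %% r)%Z.
Definition cycle i x : seqZ A := shz (cycle_shift i x) x.

Let r0 : r%:Z != 0. Proof. by have := prime_gt0 r_pr; lia. Qed.

Let r_dvd n : (n1 <= n)%N -> (r %| (p n)%:Z)%Z.
Proof. by move=> /p_dvd; rewrite dvdzE; apply: dvdn_trans. Qed.

Lemma phase_modr n a b : (n1 <= n)%N -> (p n %| a - b)%Z -> (a = b %[mod r])%Z.
Proof. by move=> /r_dvd H /(dvdz_trans H); rewrite -eqz_mod_dvd => /eqP. Qed.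

Lemma phase_modr_le n x : (n1 <= n)%N -> X x -> (phase n1 x = phase n x %[mod r])%Z.
Proof.
by move=> le Xx; apply: (@phase_modr n1) => //; apply: phase_le le Xx _; rewrite subrr dvdz0.
Qed.

Lemma modzD_congr (a b c d : int) : (a = b %[mod d])%Z -> (a + c = b + c %[mod d])%Z.
Proof. by move=> E; rewrite -modzDml E modzDml. Qed.

Lemma cycle_shift_eq i x y : (phase n1 x = phase n1 y %[mod r])%Z ->
  cycle_shift i x = cycle_shift i y.
Proof. by move=> E; rewrite /cycle_shift E (modzD_congr i E). Qed.

Lemma cycle_shift_modr i x : (r %| cycle_shift i x - i)%Z.
Proof.
have := divz_eq (phase n1 x + i) r; have := divz_eq (phase n1 x) r.
rewrite /cycle_shift => E E'; apply/dvdzP.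
by exists ((phase n1 x %/ r)%Z - ((phase n1 x + i) %/ r)%Z); lia.
Qed.

Lemma cycle_shift_lt i x : `|cycle_shift i x| < r%:Z.
Proof.
have h1 := @modz_ge0 (phase n1 x + i) _ r0; have h2 := @modz_ge0 (phase n1 x) _ r0.
have h3 := @ltz_mod (phase n1 x + i) _ r0; have h4 := @ltz_mod (phase n1 x) _ r0.
by rewrite /cycle_shift; lia.
Qed.

Lemma orbit_closure_cycle i x : X x -> X (cycle i x).
Proof. exact: orbit_closure_shz. Qed.

Lemma phase_cycle i x : X x -> (phase n1 (cycle i x) = phase n1 x + i %[mod r])%Z.
Proof.
move=> Xx; apply/eqP; rewrite eqz_mod_dvd.
have /dvdzP[q E] := cycle_shift_modr i x.
have /dvdzP[q' E'] := dvdz_trans (r_dvd (leqnn n1)) (phase_shz n1 (cycle_shift i x) Xx).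
by apply/dvdzP; exists (q + q'); rewrite /cycle; lia.
Qed.

Lemma cycleD i j x : X x -> cycle i (cycle j x) = cycle (i + j) x.
Proof.
move=> Xx; rewrite /cycle shzD -/(cycle j x); congr (shz _ x); rewrite /cycle_shift.
rewrite (modzD_congr i (phase_cycle j Xx)) (phase_cycle j Xx).
by rewrite -[phase n1 x + j + i]addrA (addrC j) subrKA.
Qed.

Lemma cycle_modr i x : (r %| i)%Z -> cycle i x = x.
Proof.
by case/dvdzP => q ->; rewrite /cycle /cycle_shift (addrC (phase n1 x)) modzMDl subrr shz0.
Qed.

Lemma cycle0 x : cycle 0 x = x.
Proof. by apply: cycle_modr; rewrite dvdz0. Qed.

Lemma cycle_aut i : aut_inverse X (cycle i) (cycle (- i)).
Proof.
have lc j x : X x -> exists M, forall y, X y -> agree M y x -> cycle_shift j y = cycle_shift j x.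
  move=> /(phase_locally_constant n1)[M HM]; exists M => y Xy yx.
  by apply: cycle_shift_eq; apply: (@phase_modr n1) => //; apply: HM.
have inv j x : X x -> cycle_shift (- j) (cycle j x) = - cycle_shift j x.
  move=> Xx; rewrite /cycle_shift (phase_cycle j Xx) (modzD_congr _ (phase_cycle j Xx)).
  by rewrite (addrK j); lia.
apply: piecewise_shift_aut (p_gt0 n1) (lc i) (lc (- i)) _ (inv i) _ => x Xx.
- by exact: orbit_closure_shz.
- apply: cycle_shift_eq; apply: (@phase_modr n1) => //.
  exact: phase_shz_period.
- by have := inv (- i) x Xx; rewrite opprK.
Qed.

Lemma cycle_iter (n : nat) x : X x -> iter n (cycle 1) x = cycle n%:Z x.
Proof.
move=> Xx; elim: n => [|n IH]; first by rewrite cycle0.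
by rewrite iterS IH cycleD // -add1n.
Qed.

(** [cycle i] acts as the iterate of [cycle 1] with exponent [i] modulo [r], for negative [i] as
    well. *)
Lemma cycle_commute g i x : aut_inf X g -> commute_on X (cycle 1) g -> X x ->
  cycle i (g x) = g (cycle i x).
Proof.
move=> Ag fg Xx; have [Af _ _ _] := cycle_aut 1.
have red y : X y -> cycle i y = iter `|(i %% r)%Z|%N (cycle 1) y.
  move=> Xy; have Xc := orbit_closure_cycle (i %% r)%Z Xy.
  rewrite cycle_iter // gez0_abs ?modz_ge0 // {1}(divz_eq i r) -cycleD // cycle_modr //.
  exact: dvdz_mull.
have gf : commute_on X g (cycle 1) by move=> y /fg.
rewrite !red //; last exact: aut_inf_into Ag Xx.
by rewrite (commute_on_iter _ Af gf Xx).
Qed.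

Lemma cycle_shz i j x : (r %| j)%Z -> X x -> cycle i (shz j x) = shz j (cycle i x).
Proof.
move=> /dvdzP[q E] Xx; rewrite /cycle (@cycle_shift_eq i (shz j x) x) ?shzD 1?addrC //.
apply/eqP; rewrite eqz_mod_dvd.
have /dvdzP[q' E'] := dvdz_trans (r_dvd (leqnn n1)) (phase_shz n1 j Xx).
by apply/dvdzP; exists (q + q'); lia.
Qed.

(* The level of [x] in [Z / p n] with its last digit cleared: an invariant of the orbits of [cycle 1]. *)
Definition block n x : int := phase n x - (phase n x %% r)%Z.

Lemma block_congr n m x y : (n <= m)%N ->
  (phase n x = phase m x %[mod r])%Z -> (phase n y = phase m y %[mod r])%Z ->
  (p n %| phase n x - phase m x)%Z -> (p n %| phase n y - phase m y)%Z ->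
  (p m %| block m x - block m y)%Z -> (p n %| block n x - block n y)%Z.
Proof.
move=> nm Ex Ey /dvdzP[q E] /dvdzP[q' E'] /dvdzP[q'' E''].
have /dvdnP[c Ec] := p_dvd nm; rewrite Ec PoszM in E''.
apply/dvdzP; exists (q - q' + q'' * c%:Z); move: E''; rewrite /block Ex Ey; lia.
Qed.

Lemma block_le n m x y : (n1 <= n)%N -> (n <= m)%N -> X x -> X y ->
  (p m %| block m x - block m y)%Z -> (p n %| block n x - block n y)%Z.
Proof.
move=> n1n nm Xx Xy.
have ph z : X z -> (p n %| phase n z - phase m z)%Z.
  by move=> Xz; apply: phase_le nm Xz _; rewrite subrr dvdz0.
by apply: block_congr nm _ _ (ph _ Xx) (ph _ Xy); apply: phase_modr n1n _; apply: ph.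
Qed.

Lemma block_phase n x y : (n1 <= n)%N -> (p n %| phase n x - phase n y)%Z ->
  (p n %| block n x - block n y)%Z.
Proof.
move=> n1n xy; have E := phase_modr n1n xy; move: xy => /dvdzP[q xy].
by apply/dvdzP; exists q; rewrite /block E; lia.
Qed.

Lemma block_cycle n i x : (n1 <= n)%N -> X x -> (p n %| block n (cycle i x) - block n x)%Z.
Proof.
move=> n1n Xx; have Xc := orbit_closure_cycle i Xx.
have E1 := phase_modr_le n1n Xx.
have E2 : (phase n (cycle i x) = phase n x + i %[mod r])%Z.
  by rewrite -(phase_modr_le n1n Xc) phase_cycle // (modzD_congr i E1).
have /dvdzP[q E] := phase_shz n (cycle_shift i x) Xx.
apply/dvdzP; exists q; rewrite /block E2; move: E.
by rewrite -/(cycle i x) /cycle_shift (modzD_congr i E1) E1; lia.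
Qed.

Definition off_cycle x y : Prop := forall i, cycle i x <> y.

Lemma off_cycle_sym x y : X x -> X y -> off_cycle x y -> off_cycle y x.
Proof.
move=> Xx Xy H i E; apply: (H (- i)); rewrite -E cycleD // addNr; exact: cycle0.
Qed.

(** If all blocks agreed, cycling [x0] by the difference of last digits would give a point with all
    the levels of [x1]; being regular, it would equal [x1]. *)
Lemma block_separation x0 x1 : regular x0 -> X x1 -> off_cycle x0 x1 ->
  exists2 n, (n1 <= n)%N & ~~ (p n %| block n x1 - block n x0)%Z.
Proof.
move=> rx0 Xx1 off; apply: NNPP => H.
have {}H n : (n1 <= n)%N -> (p n %| block n x1 - block n x0)%Z.
  by move=> n1n; apply: contraT => nd; case: H; exists n.
have [Xx0 _] := rx0.
pose i : int := phase n1 x1 - phase n1 x0; apply: (off i).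
have [Af _ _ _] := cycle_aut i; have [Xc rc] := regular_aut Af rx0.
symmetry; apply: rc => // n; apply: (phase_le_eq (leq_maxl n n1)) => //.
set m := maxn n n1; have n1m : (n1 <= m)%N := leq_maxr _ _.
have /dvdzP[q E] := phase_shz m (cycle_shift i x0) Xx0.
have /dvdzP[q' E'] := H m n1m.
apply/dvdzP; exists (q' - q); move: E'.
rewrite /block -(phase_modr_le n1m Xx1) -(phase_modr_le n1m Xx0).
by move: E; rewrite -/(cycle i x0) /cycle_shift /i (addrC (phase n1 x0)) subrK; lia.
Qed.

(** At a fine enough level the block of [x0] differs from those of the other points. [t] shifts by
    [p n] the points with the block of [x0] and fixes the rest; it commutes with [cycle 1] because
    blocks are invariant under it and [r] divides [p n]. *)
Lemma separating_automorphism x0 x1 x2 x3 : regular x0 -> X x1 -> X x2 -> X x3 ->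
  off_cycle x0 x1 -> off_cycle x0 x2 -> off_cycle x0 x3 ->
  exists t t', [/\ aut_inverse X t t', commute_on X (cycle 1) t,
    [/\ t x1 = x1, t x2 = x2 & t x3 = x3] & off_cycle x0 (t x0)].
Proof.
move=> rx0 X1 X2 X3 off1 off2 off3; have [Xx0 _] := rx0.
have [m1 le1 nb1] := block_separation rx0 X1 off1.
have [m2 le2 nb2] := block_separation rx0 X2 off2.
have [m3 le3 nb3] := block_separation rx0 X3 off3.
have [n [l1 l2 l3]] : exists n, [/\ m1 <= n, m2 <= n & m3 <= n]%N.
  by exists (maxn m1 (maxn m2 m3)); rewrite !leq_max !leqnn !orbT.
have n1n := leq_trans le1 l1.
have nS m x : (n1 <= m)%N -> (m <= n)%N -> X x -> ~~ (p m %| block m x - block m x0)%Z ->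
    (p n %| block n x - block n x0)%Z = false.
  by move=> l l' Xx nd; apply: contraNF nd; apply: block_le.
pose S x := (p n %| block n x - block n x0)%Z.
have SE x y : (p n %| block n x - block n y)%Z -> S x = S y.
  exact: dvdz_congr.
have Slc x : X x -> exists M, forall y, X y -> agree M y x -> S y = S x.
  move=> /(phase_locally_constant n)[M HM]; exists M => y Xy yx.
  by apply: SE; apply: block_phase => //; apply: HM.
have Sm x : X x -> S (shz (p n)%:Z x) = S x.
  move=> Xx; apply: SE; apply: block_phase => //.
  exact: phase_shz_period.
have It := partial_shift_aut orbit_closure_shz (p_gt0 n) Slc Sm.
do 2 eexists; split; first exact: It.
- move=> x Xx; have -> : S (cycle 1 x) = S x by apply: SE; apply: block_cycle.
  by case: (S x); rewrite ?shz0 // cycle_shz //; apply: r_dvd.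
- have fixed m x : (n1 <= m)%N -> (m <= n)%N -> X x ->
      ~~ (p m %| block m x - block m x0)%Z -> shz (if S x then (p n)%:Z else 0) x = x.
    by move=> *; rewrite /S (nS m) ?shz0.
  by split; [exact: fixed nb1|exact: fixed nb2|exact: fixed nb3].
have -> : S x0 by rewrite /S subrr dvdz0.
(* [cycle i] displaces a point by less than [r], hence by less than [p n]. *)
move=> i; rewrite /cycle => /(congr1 (shz (- (p n)%:Z))).
rewrite !shzD addNr shz0 => /(shz_fixed Xx0) E.
have := cycle_shift_lt i x0; have : (r <= p n)%N by apply: dvdn_leq (p_gt0 n) (r_dvd n1n).
by move: E; clear; lia.
Qed.

(** If [g x] were [cycle i x], the [r]-th iterate of [g] would act on [x] as [cycle (r * i)], the
    identity. *)
Lemma moved_off_cycle g x : aut_inf X g -> commute_on X (cycle 1) g -> X x ->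
  iter r g x <> x -> off_cycle x (g x).
Proof.
move=> Ag fg Xx gx i E; apply: gx.
suff it (n : nat) : iter n g x = cycle (n%:Z * i) x.
  by rewrite it cycle_modr // dvdz_mulr.
elim: n => [|n IH]; first by rewrite mul0r cycle0.
rewrite iterS IH -cycle_commute // -E cycleD //; congr (cycle _ x); lia.
Qed.

Section Centralizer.
Variables g h : seqZ A -> seqZ A.
Hypotheses (Ag : aut_inf X g) (Ah : aut_inf X h).
Hypothesis fh : commute_on X (cycle 1) h.
Hypothesis gh : forall k k' : seqZ A -> seqZ A, aut_inverse X k k' -> commute_on X (cycle 1) k ->
  commute_on X g (fun x => k (h (k' x))).
Variable y : seqZ A.
Hypotheses (ry : regular y) (gy : off_cycle y (g y)) (hy : off_cycle y (h y)).

(* Conjugating [h] by an automorphism that fixes [y], [g y], [h (g y)] but moves [h y] changes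
   [g (h y)] and leaves [h (g y)] unchanged. *)
Lemma not_off_cycle : ~ off_cycle (g y) (h y).
Proof.
move=> off; have [Xy _] := ry; have rh := regular_aut Ah ry.
have Xg := aut_inf_into Ag Xy; have Xh := aut_inf_into Ah Xy.
have Xhg := aut_inf_into Ah Xg.
have inj (k : seqZ A -> seqZ A) x x' : aut_inf X k -> X x -> X x' -> k x = k x' -> x = x'.
  move=> Ak Xx Xx' E; have [k' [_ _ _ kk]] := aut_inf_inv orbit_closure_shz Ak.
  by rewrite -(kk x) // E kk.
have off3 : off_cycle (h y) (h (g y)).
  move=> i; rewrite cycle_commute // => /(inj _ _ _ Ah (orbit_closure_cycle i Xy) Xg).
  exact: gy.
have [t [t' [It ft [ty tg th] tm]]] :=
  separating_automorphism rh Xy Xg Xhg (off_cycle_sym Xy Xh hy) (off_cycle_sym Xg Xh off) off3.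
have [At _ _ t't] := It.
apply: (tm 0); rewrite cycle0; apply: inj Ag Xh (aut_inf_into At Xh) _.
have t'y : t' y = y by rewrite -{1}ty t't.
have t'g : t' (g y) = g y by rewrite -{1}tg t't.
have /= := gh It ft Xy; rewrite t'y t'g th => ->.
exact: (gh (aut_inverse_id X) _ Xy).
Qed.

End Centralizer.

(** By [not_off_cycle], [h y] lies on the cycle of [g y]. Conjugating [h] by an automorphism that
    fixes [y] and moves [g y] off its cycle destroys this, yet [not_off_cycle] applies to the
    conjugate too. *)
Lemma centralizer_no_commuting_conjugates g h y :
  aut_inf X g -> aut_inf X h -> commute_on X (cycle 1) h ->
  regular y -> off_cycle y (g y) -> off_cycle y (h y) ->
  ~ forall k k' : seqZ A -> seqZ A, aut_inverse X k k' -> commute_on X (cycle 1) k ->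
    commute_on X g (fun x => k (h (k' x))).
Proof.
move=> Ag Ah fh ry gy hy gh; have [Xy _] := ry.
have Xsh := orbit_closure_shz.
have := not_off_cycle Ag Ah fh gh ry gy hy; case/not_all_ex_not => i /NNPP E.
have rg := regular_aut Ag ry; have [Xg _] := rg.
have [t [t' [It ft [ty _ _] tm]]] :=
  separating_automorphism rg Xy Xy Xy (off_cycle_sym Xy Xg gy) (off_cycle_sym Xy Xg gy)
    (off_cycle_sym Xy Xg gy).
have [At At' tt' t't] := It; have [Af _ _ _] := cycle_aut 1.
have t'y : t' y = y by rewrite -{1}ty t't.
have Xtg := aut_inf_into At Xg.
have hy' : t (h (t' y)) = cycle i (t (g y)) by rewrite t'y -E (cycle_commute i At ft Xg).
have ft' := commute_on_inv Af It ft.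
have Aht := aut_inf_comp Xsh Ah At'.
apply: (@not_off_cycle g (fun x => t (h (t' x))) _ _ _ _ y) => //.
- by have := aut_inf_comp Xsh At Aht.
- by apply: commute_on_comp Aht ft _; apply: commute_on_comp At' fh ft'.
- move=> k k' Ik fk; apply: (gh (fun x => k (t x)) (fun x => t' (k' x))).
    exact: aut_inverse_comp.
  exact: commute_on_comp At fk ft.
- move=> j; rewrite t'y -{1}ty (cycle_commute j At ft Xy) => E'; apply: (hy j).
  by rewrite -[LHS]t't ?E' ?t't //; [apply: aut_inf_into Ah Xy|apply: orbit_closure_cycle].
move=> j; rewrite hy' => E'; apply: (tm (- i + j)).
by rewrite -cycleD // E' cycleD // addNr cycle0.
Qed.

(** By density the [r]-th iterates of [g] and [h] move orbit points, possibly different ones.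
    Conjugating [h] inside the centralizer brings both to the same point [shz a u]. *)
Lemma free_element : has_free_element X r.
Proof.
have Xsh := orbit_closure_shz; have r1 := prime_gt1 r_pr.
have [Af _ _ _] := cycle_aut 1.
exists (cycle 1); split=> //.
- have Xu := orbit_closure_orbit 0; exists (shz 0 u) => // /(shz_fixed Xu) E.
  by have := cycle_shift_modr 1 (shz 0 u); rewrite E sub0r rpredN dvdz1; lia.
- by move=> x Xx; rewrite cycle_iter // cycle_modr.
move=> g h Ag Ah fg fh gr hr gh.
have moved (k : seqZ A -> seqZ A) : aut_inf X k -> (exists2 x, X x & iter r k x <> x) ->
    exists a, iter r k (shz a u) <> shz a u.
  move=> Ak [x Xx kx]; apply: NNPP => H; apply: kx.
  apply: fixed_orbit_fixed Xx; first exact: aut_inf_iter.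
  by move=> a; apply: NNPP => ?; apply: H; exists a.
have [a Ha] := moved _ Ag gr; have [b Hb] := moved _ Ah hr.
have Xa := orbit_closure_orbit a; have Xb := orbit_closure_orbit b.
(* [cycle i] moves [shz a u] by [b - a] modulo [r]; the remaining displacement [j] is a multiple of
   [r], so that shift commutes with [cycle 1]. *)
pose i : int := b - a; pose j : int := b - a - cycle_shift i (shz a u).
have rj : (r %| j)%Z by rewrite /j -opprB rpredN; apply: cycle_shift_modr.
pose k x := shz j (cycle i x); pose k' x := cycle (- i) (shz (- j) x).
have Ik : aut_inverse X k k'.
  apply: aut_inverse_comp (cycle_aut i) => //.
  apply: (@piecewise_shift_aut A X Xsh (fun=> j) (fun=> - j) 1) => // [x _|x _|x _].
  - by exists 0%N.
  - by exists 0%N.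
  - by rewrite opprK.
have [Ak Ak' kk' k'k] := Ik.
have kc l : commute_on X (cycle l) k.
  move=> x Xx; rewrite /k cycle_shz //; last exact: orbit_closure_cycle.
  by rewrite !cycleD // addrC.
have ka : k (shz a u) = shz b u.
  by rewrite /k /cycle !shzD; congr (shz _ u); rewrite /j; lia.
have fk' := commute_on_inv Af Ik (kc 1).
have Ahk := aut_inf_comp Xsh Ah Ak.
have := @centralizer_no_commuting_conjugates g (fun x => k' (h (k x))) (shz a u).
apply=> //.
- by have := aut_inf_comp Xsh Ak' Ahk.
- by apply: commute_on_comp Ahk fk' _; apply: commute_on_comp Ak fh (kc 1).
- exact: regular_orbit.
- exact: moved_off_cycle.
- move=> l E; apply: (moved_off_cycle Ah fh Xb Hb (i := l)).
  rewrite -ka kc // E kk' //; exact: (aut_inf_into Ah (aut_inf_into Ak Xa)).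
move=> l l' Il fl; apply: (gh (fun x => l (k' x)) (fun x => k (l' x))).
  by have := aut_inverse_comp Xsh Il (aut_inverse_sym Ik).
exact: commute_on_comp Ak' fl fk'.
Qed.

End FreeElement.

End Levels.

(** * Recovering the valuations from the group *)

Lemma prime_dvd_scale (A B : Type) (u : seqZ A) (w : seqZ B) (p q : nat -> nat) (r n : nat) :
  is_toeplitz u -> is_toeplitz w -> period_structure u p -> period_structure w q ->
  aut_inf_isomorphic (orbit_closure u) (orbit_closure w) ->
  prime r -> (r %| p n)%N -> exists m, (r %| q m)%N.
Proof.
move=> [_ nu] [_ nw] pu qw iso r_pr rpn; apply: NNPP => H.
have nq m : ~~ (r %| q m)%N by apply/negP => rq; apply: H; exists m.
apply: (no_free_element qw nw r_pr nq).
apply: has_free_element_transfer iso _; [exact: orbit_closure_shz|exact: orbit_closure_shz|].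
exact: (free_element pu nu r_pr rpn).
Qed.

(** Valuations increase along the scale, so once [r] divides some [p n] the limit is not 0 and must
    be infinite. *)
Lemma torsion_free_valuation (A : Type) (u : seqZ A) (p : nat -> nat) (r : nat) (v : option nat) :
  period_structure u p -> torsion_free_scale p -> prime r ->
  vp_is p r v <-> ((exists n, (r %| p n)%N) /\ v = None \/
                   ~ (exists n, (r %| p n)%N) /\ v = Some 0%N).
Proof.
move=> pu tf r_pr; have p0 n := p_gt0 pu n.
have dvd_logn n : (r %| p n)%N = (0 < logn r (p n))%N.
  by rewrite logn_gt0 mem_primes r_pr p0.
have lognM n m : (n <= m)%N -> (logn r (p n) <= logn r (p m))%N.
  by move=> nm; apply: dvdn_leq_log => //; apply: p_dvd pu _ _ nm.
have dvd_None n : (r %| p n)%N -> vp_is p r None.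
  rewrite dvd_logn => n0; case: (tf r r_pr) => // -[N HN].
  by have := lognM _ _ (leq_maxl n N); rewrite (HN _ (leq_maxr n N)) leqNgt n0.
case: (classic (exists n, (r %| p n)%N)) => [[n rn]|nr].
  have vN := dvd_None n rn; split=> [vv|[[_ ->]|[H _]]] //; last by case: H; exists n.
  left; split; first by exists n.
  case: v vv => // m [N HN]; have [M HM] := vN m.+1.
  by have := HM _ (leq_maxl M N); rewrite (HN _ (leq_maxr M N)) ltnn.
have z n : logn r (p n) = 0%N.
  by apply/eqP; rewrite eqn0Ngt -dvd_logn; apply/negP => rn; apply: nr; exists n.
split=> [vv|[[H _]|[_ ->]]]; last by exists 0%N.
  right; split=> //; case: v vv => [m [N HN]|H].
    by rewrite -(HN N) // z.
  by have [N /(_ N (leqnn _))] := H 1%N; rewrite z.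
by case: nr.
Qed.

Theorem theorem1p5 (A B : finType) (u : seqZ A) (w : seqZ B) (p q : nat -> nat) :
  is_toeplitz u -> is_toeplitz w ->
  period_structure u p -> period_structure w q ->
  torsion_free_scale p -> torsion_free_scale q ->
  aut_inf_isomorphic (orbit_closure u) (orbit_closure w) ->
  forall r : nat, prime r -> forall v : option nat, vp_is p r v <-> vp_is q r v.
Proof.
move=> tu tw pu qw tp tq iso r r_pr v.
have iso' : aut_inf_isomorphic (orbit_closure w) (orbit_closure u).
  by apply: aut_inf_isomorphic_sym iso; exact: orbit_closure_shz.
have E : (exists n, (r %| p n)%N) <-> (exists n, (r %| q n)%N).
  split=> -[n rn].
    exact: prime_dvd_scale tu tw pu qw iso r_pr rn.
  exact: prime_dvd_scale tw tu qw pu iso' r_pr rn.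
rewrite (torsion_free_valuation v pu tp r_pr) (torsion_free_valuation v qw tq r_pr).
tauto.
Qed.
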